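(* For every integer $n\ge 1$, there is a bijection between the set $\mathscr{SF}_n/\!\!\sim$ of equivalence classes of signed rooted forests with $n$ vertices and the set of (isomorphism classes of) rooted triangular cacti with $2n+1$ vertices and $n$ triangles.
   Context: A rooted forest is a finite acyclic graph in which every connected component has exactly one distinguished vertex, its root; the children of a vertex $i$ are the neighbours of $i$ that are farther than $i$ from the root of the component of $i$. A signed rooted forest $(\mathcal{T},\mathsf{s})$ with vertices $[n]=\{1,\dots,n\}$ is a rooted forest $\mathcal{T}$ with vertex set $[n]$ together with a map $\mathsf{s}\colon E(\mathcal{T})\to\{+,-\}$ on its edges. Two signed rooted forests $(\mathcal{T},\mathsf{s})$, $(\mathcal{T}',\mathsf{s}')$ with vertices $[n]$ are isomorphic if there is a permutation $\pi\in\mathfrak{S}_n$ that sends the roots of $\mathcal{T}$ to the roots of $\mathcal{T}'$ and induces a bijection between the edges preserving the signs. $\mathscr{SF}_n$ denotes the set of isomorphism classes of signed rooted forests with vertices $[n]$. For a vertex $i$, the operation $r_i$ changes simultaneously the signs of all edges connecting $i$ and its children. The equivalence relation $\sim$ on $\mathscr{SF}_n$ is the one generated by the operations $r_i$, $i\in[n]$ (i.e. two isomorphism classes are equivalent if representatives are related by a finite sequence of isomorphisms and operations $r_i$). A cactus is a connected (finite, simple) graph in which any two distinct simple cycles have at most one vertex in common. A triangular cactus (or $3$-cactus) is a cactus in which every cycle has length three; its $3$-cycles are called triangles. A rooted triangular cactus is a triangular cactus with a distinguished root vertex. Rooted triangular cacti are considered up to graph isomorphisms that send root to root. *)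

(* Defs.v *)
From HB Require Import structures.
From mathcomp Require Import all_boot all_fingroup.
From mathcomp Require Import generic_quotient.

Set Implicit Arguments.
Unset Strict Implicit.
Unset Printing Implicit Defensive.

Local Open Scope quotient_scope.

Record sgraph (T : finType) := SGraph {
  edges : {set {set T}};
  edgesP : [forall e in edges, #|e| == 2] }.

HB.instance Definition _ (T : finType) := [isSub for @edges T].
HB.instance Definition _ (T : finType) := [Finite of sgraph T by <:].

Section Graphs.
Variables (T : finType) (G : sgraph T).

(* Irreflexive, because [set x; x] is a singleton. *)
Definition adj : rel T := fun x y => [set x; y] \in edges G.

Definition connected := [forall x, forall y, connect adj x y].

Definition has_walk (x y : T) (k : nat) :=
  [exists p : k.-tuple T, path adj x p && (last x p == y)].

(* The graph distance; a shortest walk has fewer than #|T| edges, and the junk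
   value is #|T| when x and y are in different components. *)
Definition dist (x y : T) : nat := find (has_walk x y) (iota 0 #|T|).

Definition cycle_edges (c : seq T) : {set {set T}} :=
  [set [set x; next c x] | x in c].

(* A simple cycle is a subgraph, represented by its set of edges C: its vertex
   set is cover C and its length is #|C|. The bound on k loses nothing, since
   the vertices of a simple cycle are pairwise distinct. *)
Definition simple_cycles : {set {set {set T}}} :=
  [set C | [exists k : 'I_#|T|.+1, exists c : k.-tuple T,
     [&& 2 < k, ucycleb adj c & C == cycle_edges c]]].

Definition acyclic := simple_cycles == set0.

Definition cactus :=
  connected &&
  [forall C in simple_cycles, forall D in simple_cycles,
     (C != D) ==> (#|cover C :&: cover D| <= 1)].

Definition triangular_cactus :=
  cactus && [forall C in simple_cycles, #|C| == 3].

Definition triangles := [set C in simple_cycles | #|C| == 3].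

End Graphs.

(* A graph together with its set of roots; [n] is encoded as 'I_n. *)
Record rforest (n : nat) := RForest {
  rf_pair : sgraph 'I_n * {set 'I_n};
  rf_pairP : acyclic rf_pair.1 &&
    [forall x, #|[set r in rf_pair.2 | connect (adj rf_pair.1) x r]| == 1] }.

HB.instance Definition _ (n : nat) := [isSub for @rf_pair n].
HB.instance Definition _ (n : nat) := [Finite of rforest n by <:].

Section RootedForests.
Variables (n : nat) (F : rforest n).

Definition rf_graph : sgraph 'I_n := (rf_pair F).1.
Definition rf_roots : {set 'I_n} := (rf_pair F).2.
Definition rf_edge : finType := {e : {set 'I_n} | e \in edges rf_graph}.

Definition children (i : 'I_n) : {set 'I_n} :=
  [set j | adj rf_graph i j &&
     [exists r in rf_roots, connect (adj rf_graph) i r &&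
        (dist rf_graph r i < dist rf_graph r j)]].

Definition child_edges (i : 'I_n) : {set {set 'I_n}} :=
  [set [set i; j] | j in children i].

(* The sign + is true and the sign - is false. *)
Definition signing : finType := {ffun rf_edge -> bool}.

End RootedForests.

Definition srforest (n : nat) : finType := {F : rforest n & signing F}.

Definition mksrforest n (F : rforest n) (s : signing F) : srforest n :=
  Tagged (@signing n) s.

Definition r_op n (i : 'I_n) (X : srforest n) : srforest n :=
  mksrforest [ffun e : rf_edge (tag X) =>
    tagged X e (+) (val e \in child_edges (tag X) i)].

Definition srf_iso_by n (p : {perm 'I_n}) (X Y : srforest n) :=
  [&& p @: rf_roots (tag X) == rf_roots (tag Y),
      [set p @: (e : {set 'I_n}) | e in edges (rf_graph (tag X))]
        == edges (rf_graph (tag Y))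
    & [forall e : rf_edge (tag X), forall e' : rf_edge (tag Y),
        (p @: val e == val e') ==> (tagged X e == tagged Y e')]].

Definition srf_iso n : rel (srforest n) :=
  fun X Y => [exists p : {perm 'I_n}, srf_iso_by p X Y].

Lemma imset_perm1 (T : finType) (A : {set T}) : (1%g : {perm T}) @: A = A.
Proof.
by rewrite -[RHS]imset_id; apply: eq_imset => x; rewrite perm1.
Qed.

Lemma imset_permM (T : finType) (p q : {perm T}) (A : {set T}) :
  (p * q)%g @: A = q @: (p @: A).
Proof. by rewrite -imset_comp; apply: eq_imset => x; rewrite permM. Qed.

Lemma imset_permK (T : finType) (p : {perm T}) (A : {set T}) :
  (p^-1)%g @: (p @: A) = A.
Proof. by rewrite -imset_permM mulgV imset_perm1. Qed.

Section ImsetEdges.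
Variable T : finType.
Implicit Types (p q : {perm T}) (E : {set {set T}}).

Lemma imset_edges1 E : [set (1%g : {perm T}) @: (e : {set T}) | e in E] = E.
Proof. by rewrite -[RHS]imset_id; apply: eq_imset => e; rewrite imset_perm1. Qed.

Lemma imset_edgesM p q E : [set (p * q)%g @: (e : {set T}) | e in E] =
  [set q @: (e : {set T}) | e in [set p @: (e : {set T}) | e in E]].
Proof. by rewrite -imset_comp; apply: eq_imset => e; rewrite /= imset_permM. Qed.

Lemma imset_edgesK p E :
  [set (p^-1)%g @: (e : {set T}) | e in [set p @: (e : {set T}) | e in E]] = E.
Proof. by rewrite -imset_edgesM mulgV imset_edges1. Qed.

End ImsetEdges.

Lemma srf_iso_refl n : reflexive (@srf_iso n).
Proof.
move=> X; apply/existsP; exists 1%g.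
rewrite /srf_iso_by imset_perm1 imset_edges1 !eqxx /=.
apply/forallP=> e; apply/forallP=> e'; apply/implyP.
by rewrite imset_perm1 => /eqP/val_inj ->.
Qed.

Lemma srf_iso_symm n (X Y : srforest n) : srf_iso X Y -> srf_iso Y X.
Proof.
case/existsP=> p /and3P[/eqP hr /eqP he /forallP hs].
apply/existsP; exists (p^-1)%g; apply/and3P; split.
- by rewrite -hr imset_permK.
- by rewrite -he imset_edgesK.
apply/forallP=> e; apply/forallP=> e'; apply/implyP=> /eqP h.
have /forallP/(_ e)/implyP H := hs e'; rewrite eq_sym; apply: H.
by rewrite -h -imset_permM mulVg imset_perm1.
Qed.

Lemma srf_iso_sym n : symmetric (@srf_iso n).
Proof. by move=> X Y; apply/idP/idP; apply: srf_iso_symm. Qed.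

Lemma srf_iso_trans n : transitive (@srf_iso n).
Proof.
move=> Y X Z /existsP[p /and3P[/eqP hr /eqP he /forallP hs]].
case/existsP=> q /and3P[/eqP kr /eqP ke /forallP ks].
apply/existsP; exists (p * q)%g; apply/and3P; split.
- by rewrite imset_permM hr kr.
- by rewrite imset_edgesM he ke.
apply/forallP=> e; apply/forallP=> e'; apply/implyP; rewrite imset_permM => h.
have hpe : p @: val e \in edges (rf_graph (tag Y)).
  by rewrite -he; apply/imsetP; exists (val e) => //; apply: valP.
pose d : rf_edge (tag Y) := Sub (p @: val e) hpe.
have /forallP/(_ d)/implyP H := hs e.
have /forallP/(_ e')/implyP K := ks d.
by rewrite (eqP (H _)) ?K ?SubK.
Qed.

Canonical srf_iso_equiv n :=
  EquivRel (@srf_iso n) (@srf_iso_refl n) (@srf_iso_sym n) (@srf_iso_trans n).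

Definition SF (n : nat) := {eq_quot @srf_iso n}.

Definition srf_step n : rel (srforest n) :=
  fun X Y => srf_iso X Y || [exists i, Y == r_op i X].

(* Finite sequences of steps already form an equivalence relation, because
   srf_iso is symmetric and every r_op i is an involution. *)
Definition sf_sim n : rel (SF n) := fun a b =>
  [exists X : srforest n, exists Y : srforest n,
    [&& \pi_(SF n) X == a, \pi_(SF n) Y == b & connect (@srf_step n) X Y]].

Lemma r_opK n (i : 'I_n) : involutive (r_op i).
Proof.
case=> F s; rewrite /r_op /mksrforest /=; congr (Tagged _ _).
by apply/ffunP=> e; rewrite !ffunE addbK.
Qed.

Lemma srf_step_sym n : symmetric (@srf_step n).
Proof.
move=> X Y; rewrite /srf_step srf_iso_sym; congr (_ || _).
by apply/existsP/existsP => -[i /eqP->]; exists i; rewrite r_opK.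
Qed.

Lemma sf_sim_refl n : reflexive (@sf_sim n).
Proof.
move=> a; apply/existsP; exists (repr a); apply/existsP; exists (repr a).
by rewrite reprK !eqxx connect0.
Qed.

Lemma sf_sim_sym n : symmetric (@sf_sim n).
Proof.
have hs := sym_connect_sym (@srf_step_sym n).
by move=> a b; apply/existsP/existsP => -[X /existsP[Y /and3P[ha hb h]]];
  exists Y; apply/existsP; exists X; rewrite ha hb hs.
Qed.

Lemma sf_sim_trans n : transitive (@sf_sim n).
Proof.
move=> b a c /existsP[X /existsP[Y /and3P[ha /eqP hb h]]].
case/existsP=> X' /existsP[Y' /and3P[/eqP ha' hb' h']].
apply/existsP; exists X; apply/existsP; exists Y'; rewrite ha hb' /=.
apply: connect_trans h (connect_trans _ h').
by apply: connect1; apply/orP; left; apply/eqmodP; rewrite hb ha'.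
Qed.

Canonical sf_sim_equiv n :=
  EquivRel (@sf_sim n) (@sf_sim_refl n) (@sf_sim_sym n) (@sf_sim_trans n).

Definition SF_mod_sim (n : nat) := {eq_quot @sf_sim n}.

Record rtcactus (n : nat) := RTCactus {
  rtc_pair : sgraph 'I_(2 * n + 1) * 'I_(2 * n + 1);
  rtc_pairP : triangular_cactus rtc_pair.1 && (#|triangles rtc_pair.1| == n) }.

HB.instance Definition _ (n : nat) := [isSub for @rtc_pair n].
HB.instance Definition _ (n : nat) := [Finite of rtcactus n by <:].

Definition rtc_graph n (K : rtcactus n) := (rtc_pair K).1.
Definition rtc_root n (K : rtcactus n) := (rtc_pair K).2.

Definition rtc_iso n : rel (rtcactus n) := fun K L =>
  [exists p : {perm 'I_(2 * n + 1)},
    (p (rtc_root K) == rtc_root L) &&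
    ([set p @: (e : {set 'I_(2 * n + 1)}) | e in edges (rtc_graph K)]
       == edges (rtc_graph L))].

Lemma rtc_iso_refl n : reflexive (@rtc_iso n).
Proof. by move=> K; apply/existsP; exists 1%g; rewrite perm1 imset_edges1 !eqxx. Qed.

Lemma rtc_iso_sym n : symmetric (@rtc_iso n).
Proof.
by move=> K L; apply/existsP/existsP => -[p /andP[/eqP<- /eqP<-]];
  exists (p^-1)%g; rewrite permK imset_edgesK !eqxx.
Qed.

Lemma rtc_iso_trans n : transitive (@rtc_iso n).
Proof.
move=> L K M /existsP[p /andP[/eqP hr /eqP he]] /existsP[q /andP[/eqP kr /eqP ke]].
by apply/existsP; exists (p * q)%g; rewrite permM imset_edgesM hr he kr ke !eqxx.
Qed.

Canonical rtc_iso_equiv n :=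
  EquivRel (@rtc_iso n) (@rtc_iso_refl n) (@rtc_iso_sym n) (@rtc_iso_trans n).

Definition rtcactus_classes (n : nat) := {eq_quot @rtc_iso n}.

(* Main.v *)
Require Import Defs.
From mathcomp Require Import all_boot.
From mathcomp Require Import all_fingroup generic_quotient.

Set Implicit Arguments.
Unset Strict Implicit.
Unset Printing Implicit Defensive.

(** Both sides are encoded by the same data, a parent map
    P : 'I_n -> option ('I_n * bool) without cycles.

    A signed rooted forest on [n] is such a map: P j is None when j is a root,
    and Some (i, b) when j is a child of i along an edge of sign b.  An
    isomorphism renames the vertices, and r_i flips the sign in every value
    Some (i, b).  Two forests are therefore related by isomorphisms and
    operations r_i exactly when their parent maps are related by a permutation
    p of [n] together with a family f of sign flips (connect_flips, parent_iso,
    parent_isoI).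

    A parent map also draws a triangular cactus on option ('I_n * bool), a set
    with 2n+1 points: the root is None, and the triangle number i has the two
    twin points Some (i, true), Some (i, false) and the apex P i, which is the
    point of the triangle closest to the root.  All rooted triangular cacti
    with n triangles arise in this way (tcactus_labelling): a triangular cactus
    has neither a point with two neighbours closer to the root nor a point
    with two neighbours at its own distance, since that would create a cycle of
    length at least 4 or two triangles with a common edge.  Hence each triangle
    consists of an apex and of two twin points one step further from the
    root; a point is twin in at most one triangle, and counting points shows
    that every point but the root is twin in exactly one.

    Distances to the root are intrinsic, so an isomorphism of rooted cacti
    preserves apexes and twins: it permutes the triangles and possibly swaps
    the twins of each.  This is again a permutation p with a family f of
    flips (parent_adj_iso), acting by the same formula.  So the two equivalence
    relations agree on parent maps, and the two sets of classes are in
    bijection. *)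

(** * Adjacency and simple cycles *)

Section Graphs.
Variable V : finType.
Implicit Types (G : sgraph V) (x y a b : V) (c : seq V).

Lemma set2_eq x y a b :
  [set x; y] = [set a; b] -> (x = a /\ y = b) \/ (x = b /\ y = a).
Proof.
move=> h.
have: x \in [set a; b] by rewrite -h set21.
have: y \in [set a; b] by rewrite -h set22.
have: a \in [set x; y] by rewrite h set21.
have: b \in [set x; y] by rewrite h set22.
by rewrite !inE => /orP[]/eqP h1 /orP[]/eqP h2 /orP[]/eqP h3 /orP[]/eqP h4;
  subst; auto.
Qed.

Lemma adj_sym G : symmetric (adj G).
Proof. by move=> x y; rewrite /adj setUC. Qed.

Lemma adj_neq G x y : adj G x y -> x != y.
Proof.
move=> h; have /forall_inP/(_ _ h) := edgesP G.
by rewrite cards2 eqSS eqb1.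
Qed.

Lemma edgesE G s : s \in edges G -> exists x y, adj G x y /\ s = [set x; y].
Proof.
move=> h; have /forall_inP/(_ _ h)/cards2P[x [y [_ E]]] := edgesP G.
by exists x, y; rewrite /adj -E.
Qed.

(** The pairs x, x are left out, so that any relation draws a simple graph. *)
Definition rel_edges (e : rel V) : {set {set V}} :=
  [set s | [exists x, exists y, [&& x != y, e x y & s == [set x; y]]]].

Lemma rel_edges_card2 (e : rel V) : [forall s in rel_edges e, #|s| == 2].
Proof.
apply/forall_inP => s; rewrite inE => /existsP[x /existsP[y /and3P[h _ /eqP->]]].
by rewrite cards2 h.
Qed.

Definition graph_of (e : rel V) := SGraph (rel_edges_card2 e).

Lemma adj_graph_of (e : rel V) x y :
  adj (graph_of e) x y = (x != y) && (e x y || e y x).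
Proof.
rewrite /adj /= inE; apply/existsP/andP.
  case=> a /existsP[b /and3P[h1 h2 /eqP/set2_eq[[-> ->]|[-> ->]]]].
    by rewrite h2.
  by rewrite eq_sym h2 orbT.
case=> h /orP[] h'; [exists x | exists y]; apply/existsP;
  [exists y | exists x]; apply/and3P; split=> //; first by rewrite eq_sym.
by rewrite setUC.
Qed.

(** Equality of the image edge sets is the way isomorphisms are stated for both
    forests and cacti; every argument below uses adjacency instead. *)
Lemma imset_edges_adj (p : {perm V}) G G' :
  [set p @: (e : {set V}) | e in edges G] = edges G' <->
  (forall x y, adj G' (p x) (p y) = adj G x y).
Proof.
have im2 (q : {perm V}) x y : [set q x; q y] = q @: [set x; y].
  by rewrite imsetU1 imset_set1.
split=> [E x y | h].
  rewrite /adj -E im2 mem_imset //; exact/imset_inj/perm_inj.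
apply/setP=> s; apply/imsetP/idP => [[t /edgesE[x [y [a ->]]] ->]|].
  by rewrite -im2 -[_ \in _]/(adj G' _ _) h.
move=> /edgesE[x [y [a ->]]]; exists [set (p^-1)%g x; (p^-1)%g y].
  by rewrite -[_ \in _]/(adj G _ _) -h !permKV.
by rewrite -im2 !permKV.
Qed.

Lemma simple_cyclesP G (C : {set {set V}}) :
  reflect (exists c, [/\ 2 < size c, ucycle (adj G) c & C = cycle_edges c])
          (C \in simple_cycles G).
Proof.
rewrite inE; apply: (iffP existsP).
  case=> k /existsP[c /and3P[h1 h2 /eqP->]]; exists c; split=> //.
  by rewrite size_tuple.
case=> c [h1 h2 ->].
have hk : size c < #|V|.+1.
  by rewrite ltnS -(card_uniqP (ucycle_uniq h2)) max_card.
exists (Ordinal hk); apply/existsP; exists (in_tuple c).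
by rewrite /= h1 eqxx andbT.
Qed.

Lemma cycle_edges_rot k c : uniq c -> cycle_edges (rot k c) = cycle_edges c.
Proof.
move=> u; apply/setP=> s; apply/imsetP/imsetP => -[x xc ->]; exists x;
  by rewrite ?next_rot // ?mem_rot // in xc *.
Qed.

(** On a cycle of length 2 this fails, and both steps use the same edge; this is
    where the length bound of simple cycles enters the edge count. *)
Lemma next2_neq c x : uniq c -> 2 < size c -> x \in c -> next c (next c x) != x.
Proof.
move=> u s xc; case: (rot_to xc) => k c' E.
have u' : uniq (rot k c) by rewrite rot_uniq.
rewrite -!(next_rot k u).
have: size (rot k c) = size c by rewrite size_rot.
rewrite {}E in u' *; move: c' u' => [|y [|z c']] /=; try by move=> _ E; rewrite -E in s.
move=> /and3P[]; rewrite !inE !negb_or => /and3P[h1 h2 h3] /andP[h4 _] _ _.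
by rewrite eqxx (eq_sym y) (negbTE h1) eqxx eq_sym.
Qed.

Lemma card_cycle_edges c : uniq c -> 2 < size c -> #|cycle_edges c| = size c.
Proof.
move=> u s; rewrite card_in_imset ?(card_uniqP u) // => x y xc yc.
move=> /set2_eq[[-> //]|[E1 E2]].
by have := next2_neq u s xc; rewrite E2 -E1 eqxx.
Qed.

Lemma mem_cover_cycle_edges c x : (x \in cover (cycle_edges c)) = (x \in c).
Proof.
apply/bigcupP/idP => [[s /imsetP[y yc ->]] | xc].
  by case/set2P=> ->; rewrite ?mem_next.
by exists [set x; next c x]; rewrite ?set21 //; apply/imsetP; exists x.
Qed.

Lemma cycle_edges3 x y z : uniq [:: x; y; z] ->
  cycle_edges [:: x; y; z] = [set [set x; y]; [set y; z]; [set z; x]].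
Proof.
rewrite /= !inE negb_or andbT => /andP[/andP[h1 h2] h3].
apply/setP=> s; rewrite !inE; apply/imsetP/idP.
  case=> v; rewrite !inE => /or3P[]/eqP-> ->; rewrite /= ?eqxx ?orbT //.
    by rewrite (eq_sym y) (negbTE h1) eqxx orbT.
  by rewrite !(eq_sym z) (negbTE h2) (negbTE h3) !eqxx orbT.
case/orP=> [/orP[]|] /eqP ->; [exists x | exists y | exists z];
  rewrite ?inE ?eqxx ?orbT //= ?eqxx //.
  by rewrite (eq_sym y) (negbTE h1).
by rewrite !(eq_sym z) (negbTE h2) (negbTE h3).
Qed.

Lemma cycle_edges3_rev x y z : uniq [:: x; y; z] ->
  cycle_edges [:: x; z; y] = cycle_edges [:: x; y; z].
Proof.
move=> u; have u' : uniq [:: x; z; y].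
  by move: u; rewrite -rev_uniq -(rot_uniq 2).
rewrite !cycle_edges3 // (setUC [set x] [set z]).
rewrite (setUC [set z] [set y]) (setUC [set y] [set x]).
by rewrite setUAC [in RHS]setUC setUA.
Qed.

End Graphs.

(** * Levels and distances *)

Section Levels.
Variable V : finType.
Implicit Types (e : rel V) (R : {set V}) (l : V -> nat).

(** Such an l is the distance to the set R.  This axiomatic form is what makes
    distances easy to transport: any function with these three properties is
    the distance (leveling_uniq), so none has to be computed. *)
Definition leveling e R l :=
  [/\ forall v, (l v == 0) = (v \in R),
      forall x y, e x y -> l x <= (l y).+1 &
      forall v, 0 < l v -> exists2 u, e v u & l v = (l u).+1].

Lemma leveling_uniq e R l l' : leveling e R l -> leveling e R l' -> l =1 l'.
Proof.
suff le l1 l2 : leveling e R l1 -> leveling e R l2 -> forall v, l1 v <= l2 v.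
  by move=> h h' v; apply/eqP; rewrite eqn_leq !le.
move=> [z1 s1 _] [z2 _ d2] v; move: {2}(l2 v) (erefl (l2 v)) => k.
elim: k v => [|k IH] v E.
  by rewrite E leqn0 z1 -z2 E.
have [|u evu E'] := d2 v; first by rewrite E.
have := IH u; rewrite E' in E *; case: E => E /(_ E).
by rewrite -ltnS; apply: leq_trans; apply: s1.
Qed.

(** The hypothesis says that a component holds at most one point of R: R is the
    set of roots of a forest, or the root of a cactus. *)
Lemma one_root_connect e R x y r r' :
  symmetric e -> {in R &, forall r r', connect e r r' -> r = r'} ->
  connect e x y -> r \in R -> r' \in R -> connect e x r -> connect e y r' ->
  r = r'.
Proof.
move=> es one xy rR rR' xr yr; apply: one => //.
apply: connect_trans yr; apply: connect_trans xy.
by rewrite sym_connect_sym.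
Qed.

Definition low e l k : rel V := fun x y => [&& e x y, l x <= k & l y <= k].

Lemma low_sub e l k x y : connect (low e l k) x y -> connect e x y.
Proof. by apply: connect_sub x y => x y /and3P[h _ _]; apply: connect1. Qed.

Lemma leveling_root e R l k v : leveling e R l -> l v <= k ->
  exists2 r, r \in R & connect (low e l k) v r.
Proof.
move=> [z _ d]; move: {2}(l v) (erefl (l v)) => m.
elim: m v => [|m IH] v E lk.
  by exists v; rewrite // -z E.
have [|u evu E'] := d v; first by rewrite E.
have uk : l u <= k by rewrite ltnW // -E'.
have [||r rR ur] := IH u => //; first by move: E'; rewrite E => -[].
by exists r => //; apply: connect_trans ur; apply: connect1; apply/and3P.
Qed.

(** Points of one component remain connected inside a ball around the root,
    since both can descend to the root. *)
Lemma leveling_low e R l k x y :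
  symmetric e -> {in R &, forall r r', connect e r r' -> r = r'} ->
  leveling e R l -> connect e x y -> l x <= k -> l y <= k ->
  connect (low e l k) x y.
Proof.
move=> es one lev xy xk yk.
have [r rR xr] := leveling_root lev xk.
have [r' rR' yr] := leveling_root lev yk.
have E := one_root_connect es one xy rR rR' (low_sub xr) (low_sub yr).
apply: connect_trans xr _; rewrite E sym_connect_sym // => a b.
by rewrite /low es [(_ <= _) && _]andbC.
Qed.

(** Two points outside the ball of radius k are joined by a simple path whose
    interior lies inside: enter from x, move within the ball, leave to y.  Such a
    path avoids every other point outside the ball, so that it can be closed
    there to a simple cycle; the last clause is what makes the cycle long. *)
Lemma detour e l k x y x' y' :
  symmetric e -> connect (low e l k) x' y' -> e x x' -> e y y' ->
  l x' <= k -> k < l x -> k < l y -> x != y ->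
  exists p, [/\ path e x (rcons p y), uniq (x :: rcons p y),
    all (fun u => l u <= k) p, 0 < size p & x' != y' -> 1 < size p].
Proof.
move=> es /connectP[p0 /shortenP[p pp up _] -> {p0}] xx' yy' x'k kx ky xy.
have lp : all (fun u => l u <= k) (x' :: p).
  elim: p x' pp {up xx' yy'} x'k => [|z p IH] a /=; first by move=> _ ->.
  by case/andP => /and3P[_ -> zk] /IH /(_ zk).
have nlow z : k < l z -> z \notin x' :: p.
  by move=> kz; apply/negP => /(allP lp); rewrite leqNgt kz.
exists (x' :: p); split=> //=; last by case: (p) => //=; rewrite eqxx.
  rewrite xx' rcons_path es yy' andbT /=.
  by apply: sub_path pp => a b /and3P[].
rewrite -[_ && _]/(uniq (x :: rcons (x' :: p) y)) cons_uniq rcons_uniq.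
rewrite mem_rcons in_cons negb_or xy.
by rewrite !nlow ?up.
Qed.

(** A cycle is read from a point v of maximal level: both neighbours a and b of v
    on the cycle are then at most as high as v, which leaves few choices for
    them when the graph comes from a parent map. *)
Lemma cycle_top e l c : ucycle e c -> 2 < size c ->
  exists k v a s b, [/\ rot k c = [:: v, a & rcons s b],
    e v a, e b v, uniq [:: v, a & rcons s b] & forall u, u \in c -> l u <= l v].
Proof.
case/andP=> ce uc sc.
have [v vc vmax] : exists2 v, v \in c & forall u, u \in c -> l u <= l v.
  case: c sc {ce uc} => // x c _.
  by case: (arg_maxnP (i0 := x) (P := mem (x :: c)) l (mem_head _ _)) => v; exists v.
case: (rot_to vc) => k c' E.
have sc' : 2 < size (v :: c') by rewrite -E size_rot.
case: c' E sc' => [|a s0] // E; case/lastP: s0 E => [|s b] // E _.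
exists k, v, a, s, b; rewrite -E rot_uniq; split=> //.
  by move: ce; rewrite -(rot_cycle k) E /= => /andP[].
by move: ce; rewrite -(rot_cycle k) E (cycle_path v) /= last_rcons => /andP[].
Qed.

End Levels.

Lemma leveling_comp (U W : finType) (e : rel U) (e' : rel W)
    (R : {set U}) (R' : {set W}) (g : U -> W) (l : W -> nat) :
  bijective g -> (forall x y, e' (g x) (g y) = e x y) ->
  (forall x, (g x \in R') = (x \in R)) ->
  leveling e' R' l -> leveling e R (l \o g).
Proof.
case=> g' gK g'K he hR [z s d]; split=> [v | x y h | v] /=.
- by rewrite z hR.
- by apply: s; rewrite he.
by case/d=> u; rewrite -[u]g'K he; exists (g' u).
Qed.

Section Distance.
Variables (V : finType) (G : sgraph V).
Implicit Types (x y : V) (k : nat).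

Lemma has_walkP x y k :
  reflect (exists p, [/\ size p = k, path (adj G) x p & last x p = y])
          (has_walk G x y k).
Proof.
apply: (iffP existsP) => [[p /andP[pp /eqP <-]] | [p [sp pp pl]]].
  by exists p; rewrite size_tuple.
by move/eqP: sp => sp; exists (Tuple sp); rewrite /= pp pl eqxx.
Qed.

Lemma dist_le x y k : has_walk G x y k -> dist G x y <= k.
Proof.
move=> h; rewrite leqNgt; apply/negP => lt.
have kV : k < #|V|.
  by apply: leq_trans lt _; rewrite -[X in _ <= X](size_iota 0) find_size.
by have := before_find 0 lt; rewrite nth_iota // h.
Qed.

Lemma dist_walk x y : connect (adj G) x y -> has_walk G x y (dist G x y).
Proof.
case/connectP=> p0 /shortenP[p pp up _] -> {p0}.
have h : has (has_walk G x (last x p)) (iota 0 #|V|).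
  apply/hasP; exists (size p); last by apply/has_walkP; exists p.
  rewrite mem_iota /= add0n.
  by rewrite -[(_ < _)]/(size (x :: p) <= _) -(card_uniqP up) max_card.
have := nth_find 0 h; rewrite nth_iota ?add0n //.
by rewrite -[X in _ < X](size_iota 0) -has_find.
Qed.

(** The last edge of a shortest walk from the root gives the descent step. *)
Lemma leveling_dist (R : {set V}) (rt : V -> V) :
  (forall v, rt v \in R) -> (forall v, connect (adj G) (rt v) v) ->
  {in R &, forall r r', connect (adj G) r r' -> r = r'} ->
  leveling (adj G) R (fun v => dist G (rt v) v).
Proof.
move=> rtR rtc one.
have step r x y : connect (adj G) r y -> adj G x y -> dist G r x <= (dist G r y).+1.
  move=> /dist_walk/has_walkP[p [sp pp pl]] xy.
  apply: dist_le; apply/has_walkP; exists (rcons p x).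
  by rewrite size_rcons sp rcons_path pp pl adj_sym last_rcons.
have rtE x y : adj G x y -> rt x = rt y.
  move=> xy; apply: one => //; apply: connect_trans (rtc x) _.
  apply: connect_trans (connect1 xy) _.
  by rewrite (sym_connect_sym (adj_sym G)).
split=> [v | x y xy | v].
- apply/eqP/idP => [E | vR].
    have /dist_walk/has_walkP[p] := rtc v.
    rewrite E => -[/size0nil -> _ <-]; exact: rtR.
  have -> : rt v = v by exact: one (rtc v).
  by apply/eqP; rewrite -leqn0; apply: dist_le; apply/has_walkP; exists [::].
- by rewrite (rtE _ _ xy); apply: step.
have /dist_walk/has_walkP[p [sp pp pl]] := rtc v; rewrite -{1}sp.
case/lastP: p => [|p x] // in sp pp pl *; move: sp pp pl.
rewrite size_rcons rcons_path last_rcons => sp /andP[pp px] E _; subst x.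
set u := last (rt v) p in px; exists u; first by rewrite adj_sym.
have ru : rt u = rt v by apply: rtE.
have hw : has_walk G (rt v) u (size p) by apply/has_walkP; exists p.
apply/eqP; rewrite eqn_leq ru step -?ru // 1?adj_sym //= ru -sp ltnS.
exact: dist_le.
Qed.

End Distance.

(** * Levels in forests and in triangular cacti *)

Section ShortCycles.
Variables (V : finType) (G : sgraph V) (R : {set V}) (l : V -> nat).
Hypothesis lev : leveling (adj G) R l.
Hypothesis one : {in R &, forall r r', connect (adj G) r r' -> r = r'}.
Implicit Types x y v : V.

Let adjC := adj_sym G.

(** With two distinct lower neighbours x and y, the cycle goes from v to x, down
    to the ball below x and y, and back through y: besides v, x, y it meets at
    least one point of the ball. *)
Lemma two_parents_cycle v x y : adj G v x -> adj G v y -> x != y ->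
  l v = (l x).+1 -> l v = (l y).+1 ->
  exists c, ucycle (adj G) c /\ 3 < size c.
Proof.
have [z _ d] := lev; move=> vx vy xy lx ly.
have lxy : l x = l y by apply: succn_inj; rewrite -lx.
have cxy : connect (adj G) x y.
  by apply: connect_trans (connect1 vy); rewrite connect1 // adjC.
case E: (l x) => [|k].
  by case/eqP: xy; apply: one; rewrite // -z -?lxy E.
have [|x' xx' ex'] := d x; first by rewrite E.
have [|y' yy' ey'] := d y; first by rewrite -lxy E.
have kx' : l x' <= k by rewrite -ltnS -ex' E.
have ky' : l y' <= k by rewrite -ltnS -ey' -lxy E.
have cxy' : connect (adj G) x' y'.
  apply: connect_trans (connect1 yy'); apply: connect_trans cxy.
  by rewrite connect1 // adjC.
have lw := leveling_low adjC one lev cxy' kx' ky'.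
have [||p [pp up ap sp _]] := detour adjC lw xx' yy' kx' _ _ xy.
- by rewrite E.
- by rewrite -lxy E.
exists [:: v, x & rcons p y]; split; last by rewrite /= size_rcons !ltnS.
apply/andP; split.
  by rewrite /= rcons_path pp last_rcons vx adjC vy.
rewrite cons_uniq up andbT in_cons mem_rcons in_cons !negb_or.
rewrite !(adj_neq vx) (adj_neq vy) /=; apply/negP => /(allP ap).
by rewrite lx E ltnNge leqW.
Qed.

(** An edge between points of equal level is closed up through the ball that
    contains their parents. The cycle is a triangle only if the parents agree. *)
Lemma level_edge_cycle x y x' y' : adj G x y -> adj G x x' -> adj G y y' ->
  l x = l y -> l x = (l x').+1 -> l y = (l y').+1 ->
  exists c, [/\ ucycle (adj G) c, 2 < size c & x' != y' -> 3 < size c].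
Proof.
move=> xy xx' yy' lxy lx ly.
have lxy' : l x' = l y' by apply: succn_inj; rewrite -lx -ly.
have cxy' : connect (adj G) x' y'.
  apply: connect_trans (connect1 yy'); apply: connect_trans (connect1 xy).
  by rewrite connect1 // adjC.
have lw : connect (low (adj G) l (l x')) x' y'.
  by apply: (leveling_low adjC one lev cxy'); rewrite ?lxy'.
have [||p [pp up ap sp pn]] := detour adjC lw xx' yy' (leqnn _) _ _ (adj_neq xy).
- by rewrite lx.
- by rewrite ly lxy'.
exists (x :: rcons p y); split; rewrite ?size_rcons //= ?ltnS ?size_rcons //.
apply/andP; split=> //.
by rewrite /= rcons_path pp last_rcons adjC.
Qed.

Lemma level_edge_pos x y : adj G x y -> l x = l y -> 0 < l x.
Proof.
have [z _ _] := lev; move=> xy lxy; rewrite lt0n z.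
apply/negP => xR; have yR : y \in R by rewrite -z -lxy z.
by have := adj_neq xy; rewrite (one xR yR (connect1 xy)) eqxx.
Qed.

Section Acyclic.
Hypothesis ac : acyclic G.

Lemma acyclic_no_cycle c : ucycle (adj G) c -> size c <= 2.
Proof.
move=> uc; rewrite leqNgt; apply/negP => sc.
have : cycle_edges c \in simple_cycles G by apply/simple_cyclesP; exists c.
by rewrite (eqP ac) inE.
Qed.

Lemma forest_parent_uniq v x y : adj G v x -> adj G v y ->
  l v = (l x).+1 -> l v = (l y).+1 -> x = y.
Proof.
move=> vx vy lx ly; apply/eqP/contraT => xy.
have [c [uc sc]] := two_parents_cycle vx vy xy lx ly.
by have := leq_trans (ltnW sc) (acyclic_no_cycle uc).
Qed.

Lemma forest_no_level_edge x y : adj G x y -> l x != l y.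
Proof.
move=> xy; apply/eqP => lxy; have px := level_edge_pos xy lxy.
have [_ _ d] := lev; have [x' xx' lx] := d _ px.
rewrite lxy in px; have [y' yy' ly] := d _ px.
have [c [uc sc _]] := level_edge_cycle xy xx' yy' lxy lx ly.
by have := leq_trans sc (acyclic_no_cycle uc).
Qed.

End Acyclic.

Section Cactus.
Hypothesis tc : triangular_cactus G.

Lemma tcactus_cycle3 c : ucycle (adj G) c -> 2 < size c -> size c = 3.
Proof.
move=> uc sc; have C : cycle_edges c \in simple_cycles G.
  by apply/simple_cyclesP; exists c.
have /andP[_ /forall_inP/(_ _ C)/eqP] := tc.
by rewrite card_cycle_edges // (ucycle_uniq uc).
Qed.

Lemma tcactus_share2 C D v w : C \in simple_cycles G -> D \in simple_cycles G ->
  v != w -> v \in cover C -> v \in cover D -> w \in cover C -> w \in cover D ->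
  C = D.
Proof.
move=> hC hD vw vC vD wC wD; apply/eqP/contraT => CD.
have /andP[/andP[_ /forall_inP/(_ _ hC)/forall_inP/(_ _ hD)]] := tc.
rewrite CD /= => h _; move: h; rewrite leqNgt => /negP[].
apply: leq_trans (_ : #|[set v; w]| <= _); first by rewrite cards2 vw.
by apply/subset_leq_card/subsetP => u /set2P[] ->; rewrite inE ?vC ?wC.
Qed.

Lemma triangle_simple_cycle x y z : adj G x y -> adj G y z -> adj G z x ->
  cycle_edges [:: x; y; z] \in simple_cycles G.
Proof.
move=> xy yz zx; apply/simple_cyclesP; exists [:: x; y; z]; split=> //.
rewrite /ucycle /= xy yz zx !inE negb_or (adj_neq xy) (adj_neq yz).
by rewrite eq_sym (adj_neq zx).
Qed.

Lemma tcactus_parent_uniq v x y : adj G v x -> adj G v y ->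
  l v = (l x).+1 -> l v = (l y).+1 -> x = y.
Proof.
move=> vx vy lx ly; apply/eqP/contraT => xy.
have [c [uc sc]] := two_parents_cycle vx vy xy lx ly.
by have := tcactus_cycle3 uc (ltnW sc) => E; rewrite E in sc.
Qed.

Lemma tcactus_same_parent x y p : adj G x y -> l x = l y -> adj G x p ->
  l x = (l p).+1 -> adj G y p.
Proof.
move=> xy lxy xp lx; have := level_edge_pos xy lxy; rewrite lxy => py.
have [_ _ d] := lev; have [q yq ly] := d _ py.
have [c [uc sc sc']] := level_edge_cycle xy xp yq lxy lx ly.
case: (eqVneq p q) => [-> //|/sc'].
by rewrite (tcactus_cycle3 uc).
Qed.

(** Two neighbours x, y of v at the level of v share the parent p of v, so the
    triangles v x p and v y p have the two points v and p in common. *)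
Lemma tcactus_twin_uniq v x y : adj G v x -> adj G v y ->
  l v = l x -> l v = l y -> x = y.
Proof.
move=> vx vy lx ly; have [_ _ d] := lev.
have [p vp lp] := d _ (level_edge_pos vx lx).
have xp := tcactus_same_parent vx lx vp lp.
have yp := tcactus_same_parent vy ly vp lp.
rewrite adjC in vp.
have hx := triangle_simple_cycle vx xp vp.
have hy := triangle_simple_cycle vy yp vp.
rewrite adjC in vp.
have E : cycle_edges [:: v; x; p] = cycle_edges [:: v; y; p].
  by apply: tcactus_share2 hx hy (adj_neq vp) _ _ _ _;
    rewrite mem_cover_cycle_edges !inE eqxx ?orbT.
have : [set v; x] \in cycle_edges [:: v; y; p].
  rewrite -E cycle_edges3 ?inE ?eqxx //.
  by rewrite /= !inE negb_or (adj_neq vx) (adj_neq vp) (adj_neq xp).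
rewrite cycle_edges3; last first.
  by rewrite /= !inE negb_or (adj_neq vy) (adj_neq vp) (adj_neq yp).
rewrite !inE => /orP[/orP[]|]/eqP/set2_eq[] [e1 e2] //.
- by have := adj_neq vy; rewrite e1 eqxx.
- by have := adj_neq vy; rewrite e1 eqxx.
- by have := adj_neq vp; rewrite e1 eqxx.
by have := adj_neq xp; rewrite e2 eqxx.
Qed.

(** The three levels of a triangle differ by at most 1.  Starting from a point of
    minimal level, every pattern other than k, k+1, k+1 contradicts the
    uniqueness of lower neighbours or of neighbours at equal level. *)
Lemma triangle_levels C : C \in triangles G ->
  exists t : V * V * V, let: (p, v, w) := t in
    [/\ C = cycle_edges [:: p; v; w], uniq [:: p; v; w],
        [/\ adj G p v, adj G v w & adj G w p],
        l v = (l p).+1 & l w = (l p).+1].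
Proof.
rewrite inE => /andP[/simple_cyclesP[c [sc uc ->]] _].
have E := tcactus_cycle3 uc sc.
have key p v w : ucycle (adj G) [:: p; v; w] -> l p <= l v -> l p <= l w ->
  [/\ uniq [:: p; v; w],
      [/\ adj G p v, adj G v w & adj G w p],
        l v = (l p).+1 & l w = (l p).+1].
  case/andP=> /= /and4P[pv vw wp _] u pvl pwl; rewrite -/(uniq [:: p; v; w]) in u.
  have [_ s _] := lev.
  have lv : l v <= (l p).+1 by apply: s; rewrite adjC.
  have lw : l w <= (l p).+1 by apply: s.
  have pw : adj G p w by rewrite adjC.
  have vp : adj G v p by rewrite adjC.
  have wv : adj G w v by rewrite adjC.
  move: lv pvl; rewrite leq_eqVlt ltnS => /orP[/eqP ev _|lv pvl].
    move: lw pwl; rewrite leq_eqVlt ltnS => /orP[/eqP ew _|lw pwl]; first by split.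
    have ew : l p = l w by apply/eqP; rewrite eqn_leq pwl lw.
    have := adj_neq pw.
    by rewrite (@tcactus_parent_uniq v p w) ?eqxx // -ew.
  have ev : l p = l v by apply/eqP; rewrite eqn_leq pvl lv.
  move: lw pwl; rewrite leq_eqVlt ltnS => /orP[/eqP ew _|lw pwl].
    have := adj_neq pv.
    by rewrite (@tcactus_parent_uniq w p v) ?eqxx // -ev.
  have ew : l p = l w by apply/eqP; rewrite eqn_leq pwl lw.
  by have := adj_neq vw; rewrite (@tcactus_twin_uniq p v w) ?eqxx.
have rot_key k p v w : rot k c = [:: p; v; w] -> l p <= l v -> l p <= l w ->
  exists t : V * V * V, let: (p, v, w) := t in
    [/\ cycle_edges c = cycle_edges [:: p; v; w], uniq [:: p; v; w],
        [/\ adj G p v, adj G v w & adj G w p],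
        l v = (l p).+1 & l w = (l p).+1].
  move=> er h1 h2; exists (p, v, w).
  have ur : ucycle (adj G) [:: p; v; w].
    by rewrite -er /ucycle rot_cycle rot_uniq.
  have [h3 h4 h5 h6] := key _ _ _ ur h1 h2.
  by split=> //; rewrite -er cycle_edges_rot // (ucycle_uniq uc).
case: c E {sc uc key} rot_key => [|x [|y [|z []]]] // _ rot_key.
case: (leqP (l x) (l y)) => xy; case: (leqP (l x) (l z)) => xz.
- exact: (rot_key 0 x y z).
- by apply: (rot_key 2 z x y) => //; [exact: ltnW | exact: leq_trans (ltnW xz) xy].
- by apply: (rot_key 1 y z x) => //; [exact: leq_trans (ltnW xy) xz | exact: ltnW].
case: (leqP (l y) (l z)) => yz.
  by apply: (rot_key 1 y z x) => //; exact: ltnW.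
by apply: (rot_key 2 z x y) => //; exact: ltnW.
Qed.

End Cactus.

End ShortCycles.

(** * Parent maps *)

Section ParentMaps.
Variable n : nat.
Local Notation pt := (option ('I_n * bool)).
Implicit Types (P Q : 'I_n -> pt) (l : 'I_n -> nat) (x y : pt).

Definition level l x := if x is Some (i, _) then (l i).+1 else 0.

(** A function of this kind exists only if iterating P from any vertex reaches
    None; it is then the number of steps needed. *)
Definition depth P l := forall i, l i = level l (P i).

Definition apex_twin P x y :=
  if x is Some (i, b) then (y == P i) || (y == Some (i, ~~ b)) else false.

Definition parent_adj P : rel pt := fun x y => apex_twin P x y || apex_twin P y x.

Lemma apex_twinP P l x y : depth P l -> apex_twin P x y ->
  exists i b, x = Some (i, b) /\
    (y = P i /\ level l x = (level l y).+1 \/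
     y = Some (i, ~~ b) /\ level l x = level l y).
Proof.
move=> dP; case: x => [[i b]|] //= /orP[]/eqP->; exists i, b; split=> //.
  by left; rewrite /= -dP.
by right.
Qed.

Lemma parent_adj_leveling P l :
  depth P l -> leveling (parent_adj P) [set None] (level l).
Proof.
move=> dP; split=> [[[i b]|] | x y | [[i b]|]] //.
- by rewrite in_set1.
- by rewrite in_set1 eqxx.
- by case/orP=> /(apex_twinP dP)[i [b [_ [[_ ->]|[_ ->]]]]]; rewrite ?leqnSn // leqW.
by exists (P i); rewrite /parent_adj /= ?eqxx // -dP.
Qed.

Lemma parent_adj_irr P l x : depth P l -> parent_adj P x x = false.
Proof.
move=> dP; apply/negP; rewrite /parent_adj orbb => /(apex_twinP dP)[i [b [-> [[_]|[[]]]]]].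
  by move/n_Sn.
by case: b.
Qed.

Lemma parent_adj_lower P l i b y : depth P l -> parent_adj P (Some (i, b)) y ->
  level l y < level l (Some (i, b)) -> y = P i.
Proof.
move=> dP /orP[/orP[]/eqP-> //|/(apex_twinP dP)[j [c [-> [[-> ->]|[_ ->]]]]]].
- by rewrite /= ltnn.
- by rewrite ltnNge leqnSn.
by rewrite ltnn.
Qed.

Lemma parent_adj_twin P l i b y : depth P l -> parent_adj P (Some (i, b)) y ->
  level l y = level l (Some (i, b)) -> y = Some (i, ~~ b).
Proof.
move=> dP /orP[/orP[]/eqP-> //|/(apex_twinP dP)[j [c [-> [[_ ->]|[[-> ->] _]]]]]].
- by rewrite -dP => /n_Sn.
- by move/esym/n_Sn.
by rewrite negbK.
Qed.

(** The common action on both sides: p renames the vertices of a forest or the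
    triangles of a cactus, and f flips signs below a vertex or swaps twins. *)
Definition relabel (p : {perm 'I_n}) (f : 'I_n -> bool) x : pt :=
  if x is Some (i, b) then Some (p i, b (+) f i) else None.

Lemma relabel_bij p f : bijective (relabel p f).
Proof.
by apply: injF_bij; case=> [[i b]|] [[j c]|] //= [/perm_inj -> /addIb ->].
Qed.

Lemma parent_adj_relabel P Q (p : {perm 'I_n}) f :
  (forall i, Q (p i) = relabel p f (P i)) ->
  forall x y, parent_adj Q (relabel p f x) (relabel p f y) = parent_adj P x y.
Proof.
move=> h; have inj := bij_inj (relabel_bij p f).
suff apex_twinE x y : apex_twin Q (relabel p f x) (relabel p f y) = apex_twin P x y.
  by move=> x y; rewrite /parent_adj !apex_twinE.
case: x => [[i b]|] //=; rewrite h (inj_eq inj) -addNb.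
by rewrite -[Some _]/(relabel p f (Some (i, ~~ b))) (inj_eq inj).
Qed.

(** A graph isomorphism that fixes None preserves levels, since they are
    distances to None.  A neighbour at equal level is the twin and a lower
    neighbour is the apex, so the isomorphism respects both. *)
Lemma parent_adj_iso P Q l m (g : pt -> pt) :
  depth P l -> depth Q m -> bijective g -> g None = None ->
  (forall x y, parent_adj Q (g x) (g y) = parent_adj P x y) ->
  exists (p : {perm 'I_n}) f, forall i, Q (p i) = relabel p f (P i).
Proof.
move=> dP dQ bg g0 hg; have gI := bij_inj bg.
have lg x : level m (g x) = level l x.
  apply: (@leveling_uniq _ (parent_adj P) [set None] (level m \o g) (level l));
    last exact: parent_adj_leveling.
  apply: leveling_comp (parent_adj_leveling dQ) => // y.
  by rewrite !inE -{1}g0 (inj_eq gI).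
have gS i b : exists jc, g (Some (i, b)) = Some jc.
  case E: (g _) => [jc|]; first by exists jc.
  by have := lg (Some (i, b)); rewrite E.
have [p0 Hp0] := fin_all_exists (fun i => gS i true).
have Hp1 i : g (Some (i, false)) = Some ((p0 i).1, ~~ (p0 i).2).
  apply: (@parent_adj_twin Q m); rewrite // -?surjective_pairing -?Hp0 ?lg //.
  by rewrite hg /parent_adj /= eqxx orbT.
(* f i tells whether g swaps the names of the twins of triangle i. *)
pose f i := ~~ (p0 i).2.
have Hp i b : g (Some (i, b)) = Some ((p0 i).1, b (+) f i).
  case: b; last exact: Hp1.
  by rewrite Hp0 /f /= negbK -surjective_pairing.
have pI : injective (fun i => (p0 i).1).
  move=> i j E; have := Hp i (f i); rewrite addbb E -(addbb (f j)) -Hp.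
  by move/gI => [].
exists (perm pI), f => i.
have -> : relabel (perm pI) f (P i) = g (P i).
  by case: (P i) => [[j b]|] //=; rewrite permE Hp.
rewrite permE; apply/esym; apply: (@parent_adj_lower Q m _ (true (+) f i)) => //.
  by rewrite -Hp hg /parent_adj /= eqxx.
by rewrite -Hp !lg /= ltnS dP.
Qed.

End ParentMaps.

(** * Labelling the points of a cactus by a parent map *)

(** A chart of the cactus G by the standard points of the parent map P. *)
Definition labelling n (V : finType) (G : sgraph V) (r : V)
    (P : 'I_n -> option ('I_n * bool)) (h : option ('I_n * bool) -> V) :=
  [/\ bijective h, h None = r & forall x y, adj G (h x) (h y) = parent_adj P x y].

Section CactusOfParents.
Variables (n : nat) (V : finType) (G : sgraph V) (r : V).
Local Notation pt := (option ('I_n * bool)).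
Variables (P : 'I_n -> pt) (l : 'I_n -> nat) (h : pt -> V).
Hypotheses (dP : depth P l) (lab : labelling G r P h).

Let hB : bijective h. Proof. by case: lab. Qed.
Let hI : injective h. Proof. exact: bij_inj. Qed.
Let hA x y : adj G (h x) (h y) = parent_adj P x y. Proof. by case: lab. Qed.

Lemma labelling_leveling :
  exists2 lv : V -> nat, leveling (adj G) [set r] lv &
    forall x, lv (h x) = level l x.
Proof.
have [g hK gK] := hB; exists (level l \o g) => [|x /=]; last by rewrite hK.
apply: leveling_comp (parent_adj_leveling dP).
- by exists h.
- by move=> x y; rewrite -hA !gK.
by move=> x; rewrite !in_set1 -(inj_eq hI) gK; case: lab => _ ->.
Qed.

Definition parent_triangle i :=
  cycle_edges [:: h (P i); h (Some (i, true)); h (Some (i, false))].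

Lemma parent_neq i b : (P i == Some (i, b)) = false.
Proof.
by apply/eqP => E; have := dP i; rewrite E => /n_Sn.
Qed.

Lemma parent_triangle_uniq i :
  uniq [:: h (P i); h (Some (i, true)); h (Some (i, false))].
Proof.
rewrite /= !inE !(inj_eq hI) !parent_neq /= andbT.
by apply/eqP => -[].
Qed.

Lemma parent_triangle_swap i b :
  cycle_edges [:: h (P i); h (Some (i, b)); h (Some (i, ~~ b))] =
  parent_triangle i.
Proof. by case: b => //; apply: cycle_edges3_rev; apply: parent_triangle_uniq. Qed.

Lemma parent_triangle_simple_cycle i : parent_triangle i \in simple_cycles G.
Proof.
apply: triangle_simple_cycle; rewrite hA /parent_adj /= eqxx ?orbT //.
Qed.

(** The highest point v of a cycle is a twin point, and its two neighbours on the
    cycle are its apex and its twin.  The twin is as high as v, so its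
    neighbours on the cycle are the apex and v, and the cycle closes. *)
Lemma simple_cycle_parent_triangle C :
  C \in simple_cycles G -> exists i, C = parent_triangle i.
Proof.
case/simple_cyclesP=> c [sc uc ->].
have [lv levV lvE] := labelling_leveling.
have [k [v [a [s [b [E va bv u vmax]]]]]] := cycle_top lv uc sc.
have inc x : x \in [:: v, a & rcons s b] -> x \in c by rewrite -E mem_rot.
have [g hK gK] := hB.
have low_nbr i be x : adj G (h (Some (i, be))) x -> lv x <= lv (h (Some (i, be))) ->
    x = h (P i) \/ x = h (Some (i, ~~ be)).
  rewrite -[x]gK hA !lvE => ax; rewrite leq_eqVlt => /orP[/eqP|] lx.
    by right; rewrite (parent_adj_twin dP ax).
  by left; rewrite (parent_adj_lower dP ax).
have [i [be Ev]] : exists i be, v = h (Some (i, be)).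
  case Eg: (g v) => [[i be]|]; first by exists i, be; rewrite -Eg gK.
  have : lv a <= lv v by apply/vmax/inc; rewrite !inE eqxx orbT.
  rewrite -[a]gK -[v]gK Eg !lvE leqn0.
  have [z _ _] := parent_adj_leveling dP; rewrite z in_set1 => /eqP ga.
  by have := adj_neq va; rewrite -[a]gK -[v]gK Eg ga eqxx.
subst v; exists i.
have ltwin x : lv (h (Some (i, x))) = lv (h (Some (i, be))) by rewrite !lvE.
have ha : a = h (P i) \/ a = h (Some (i, ~~ be)).
  by apply: low_nbr va _; apply/vmax/inc; rewrite !inE eqxx orbT.
have hb : b = h (P i) \/ b = h (Some (i, ~~ be)).
  apply: low_nbr; first by rewrite adj_sym.
  by apply/vmax/inc; rewrite !inE mem_rcons mem_head !orbT.
have ab : a != b.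
  move: u; rewrite /= mem_rcons inE negb_or => /and3P[_ /andP[]] //.
have pth : path (adj G) a (rcons s b).
  have := uc; rewrite /ucycle -(rot_cycle k) E /= rcons_path.
  by case/andP=> /and3P[].
rewrite -(cycle_edges_rot k (ucycle_uniq uc)) {}E.
have twin_nbr x : adj G (h (Some (i, ~~ be))) x -> x \in c ->
    x = h (P i) \/ x = h (Some (i, be)).
  by move=> ax xc; have := low_nbr _ _ _ ax; rewrite negbK ltwin; apply; apply: vmax.
case: ha hb ab => Ea [] Eb; rewrite Ea Eb ?eqxx // => _; subst a b.
  (* a is the apex and b the twin of v: the point x before b would be another
     neighbour of b at most as high as b. *)
  case/lastP: s u inc pth => [|s x] u inc pth.
    by rewrite -(@cycle_edges_rot _ 1) // -(parent_triangle_swap i (~~ be)) negbK.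
  have xc : x \in c by apply/inc; rewrite !(in_cons, mem_rcons) eqxx !orbT.
  move: pth; rewrite !rcons_path !last_rcons => /andP[_].
  rewrite adj_sym => /twin_nbr/(_ xc)[].
    by move=> E; move: u; rewrite E /= !(in_cons, mem_rcons) eqxx !orbT andbF.
  by move=> E; move: u; rewrite E /= !(in_cons, mem_rcons) eqxx !orbT.
(* a is the twin of v and b its apex: the same for the point x after a. *)
case: s u inc pth => [|x s] u inc pth.
  by rewrite -(@cycle_edges_rot _ 2) // -(parent_triangle_swap i be).
have xc : x \in c by apply/inc; rewrite !in_cons eqxx !orbT.
move: pth => /= /andP[/twin_nbr/(_ xc)[] E _].
  by move: u; rewrite E /= mem_rcons mem_head !andbF.
by move: u; rewrite E /= !in_cons eqxx !orbT.
Qed.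

Lemma simple_cyclesE : simple_cycles G = [set parent_triangle i | i : 'I_n].
Proof.
apply/setP => C; apply/idP/imsetP => [/simple_cycle_parent_triangle[i ->]|[i _ ->]].
  by exists i.
exact: parent_triangle_simple_cycle.
Qed.

Lemma card_parent_triangle i : #|parent_triangle i| = 3.
Proof. by rewrite card_cycle_edges ?parent_triangle_uniq. Qed.

Lemma mem_cover_parent_triangle i u : u \in cover (parent_triangle i) ->
  u = h (P i) \/ exists b, u = h (Some (i, b)).
Proof.
rewrite mem_cover_cycle_edges !inE => /or3P[]/eqP->; first by left.
  by right; exists true.
by right; exists false.
Qed.

(** Distinct triangles have disjoint pairs of twins, so a common point is the apex
    of one of them.  If each apex were a twin point of the other triangle, each
    would have a higher level than the other. *)
Lemma card_cover_triangleI i j : i != j ->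
  #|cover (parent_triangle i) :&: cover (parent_triangle j)| <= 1.
Proof.
move=> ij; have nij b c : h (Some (i, b)) <> h (Some (j, c)).
  by move/hI => [] /eqP; rewrite (negbTE ij).
have nP b c : h (P i) = h (Some (j, b)) -> h (P j) = h (Some (i, c)) -> False.
  move=> /hI Ei /hI Ej; have := dP i; have := dP j; rewrite Ei Ej /= => -> /eqP.
  by rewrite -addn2 -{1}[l i]addn0 eqn_add2l.
have memI u : u \in cover (parent_triangle i) :&: cover (parent_triangle j) ->
    [\/ u = h (P i) /\ u = h (P j), u = h (P i) /\ exists b, u = h (Some (j, b))
      | u = h (P j) /\ exists b, u = h (Some (i, b))].
  rewrite inE => /andP[/mem_cover_parent_triangle[->|[b ->]]]
    /mem_cover_parent_triangle[E|[c E]]; first by constructor 1.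
  - by constructor 2; split=> //; exists c.
  - by constructor 3; split=> //; exists b.
  by case/nij: E.
apply/card_le1_eqP => u w /memI mu /memI mw.
case: mu => [[-> Ep]|[-> [b Eb]]|[-> [b Eb]]];
  case: mw => [[-> Eq]|[-> [c Ec]]|[-> [c Ec]]] //.
  by case: (nP b c).
by case: (nP c b).
Qed.

Lemma parent_triangle_inj : injective parent_triangle.
Proof.
move=> i j E; apply/eqP/contraT => /card_cover_triangleI; rewrite E setIid.
have sub : [set h (Some (j, true)); h (Some (j, false))]
    \subset cover (parent_triangle j).
  by apply/subsetP => u /set2P[] ->; rewrite mem_cover_cycle_edges !inE eqxx !orbT.
move=> /(leq_trans (subset_leq_card sub)).
by rewrite cards2 (inj_eq hI) (inj_eq Some_inj) xpair_eqE andbF.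
Qed.

Lemma labelling_triangles : triangles G = [set parent_triangle i | i : 'I_n].
Proof.
rewrite -simple_cyclesE; apply/setP=> C; rewrite inE.
by case: (boolP (C \in _)) => //
  /simple_cycle_parent_triangle[i ->]; rewrite card_parent_triangle.
Qed.

Lemma labelling_tcactus : triangular_cactus G && (#|triangles G| == n).
Proof.
rewrite labelling_triangles card_imset ?card_ord ?eqxx ?andbT;
  last exact: parent_triangle_inj.
apply/andP; split; last first.
  apply/forall_inP => C /simple_cycle_parent_triangle[i ->].
  by rewrite card_parent_triangle.
apply/andP; split; last first.
  apply/forall_inP => C /simple_cycle_parent_triangle[i ->].
  apply/forall_inP => D /simple_cycle_parent_triangle[j ->].
  by apply/implyP => nC; apply: card_cover_triangleI; apply: contraNneq nC => ->.
have [lv levV _] := labelling_leveling.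
have root x : connect (adj G) x r.
  have [y /set1P-> ] := leveling_root levV (leqnn (lv x)); exact: low_sub.
apply/forallP => x; apply/forallP => y; apply: connect_trans (root x) _.
by rewrite (sym_connect_sym (@adj_sym _ G)).
Qed.

End CactusOfParents.

(** The triangles are enumerated, and the two twins of each are named arbitrarily.
    The resulting map from option ('I_n * bool) is injective because the parent
    of a point and the point itself determine the triangle; it is bijective
    because both sides have 2n+1 elements, which is how the number of
    triangles enters. *)
Lemma tcactus_labelling n (V : finType) (G : sgraph V) (r : V) :
  triangular_cactus G -> #|triangles G| = n -> #|V| = (n.*2).+1 ->
  exists P l h, @labelling n V G r P h /\ depth P l.
Proof.
move=> tc ct cV; have conn : connected G by case/andP: tc => /andP[].
have conn2 x y : connect (adj G) x y by have /forallP/(_ x)/forallP/(_ y) := conn.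
have one : {in [set r] &, forall r1 r2, connect (adj G) r1 r2 -> r1 = r2}.
  by move=> r1 r2 /set1P-> /set1P->.
have lev : leveling (adj G) [set r] (fun v => dist G r v).
  apply: (@leveling_dist _ G [set r] (fun=> r)) => // v; exact: set11.
set lv := fun v => dist G r v in lev.
have [z s d] := lev.
subst n; pose n := #|triangles G|.
have tP (i : 'I_n) := triangle_levels lev one tc (enum_valP i).
have [t Ht] := fin_all_exists tP.
pose p i := (t i).1.1.
pose h (x : option ('I_n * bool)) : V :=
  if x is Some (i, b) then if b then (t i).1.2 else (t i).2 else r.
have Hc i : enum_val i = cycle_edges [:: p i; h (Some (i, true)); h (Some (i, false))].
  by have := Ht i; rewrite /p /=; case: (t i) => [[a b] c] [].
have Hu i : uniq [:: p i; h (Some (i, true)); h (Some (i, false))].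
  by have := Ht i; rewrite /p /=; case: (t i) => [[a b] c] [].
have Ha i b : adj G (h (Some (i, b))) (p i) /\
    adj G (h (Some (i, b))) (h (Some (i, ~~ b))).
  have := Ht i; rewrite /p /=; case: (t i) => [[u v] w] [_ _ [uv vw wu] _ _].
  by case: b => /=; split; rewrite // adj_sym.
have Hl i b : lv (h (Some (i, b))) = (lv (p i)).+1.
  by have := Ht i; rewrite /p /=; case: (t i) => [[u v] w] [_ _ _]; case: b.
have par i b x : adj G (h (Some (i, b))) x -> lv x < lv (h (Some (i, b))) -> x = p i.
  move=> ax lx; apply: (tcactus_parent_uniq lev one tc ax (Ha i b).1) (Hl i b).
  by apply/eqP; rewrite eqn_leq lx s.
have twin i b x : adj G (h (Some (i, b))) x -> lv x = lv (h (Some (i, b))) ->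
    x = h (Some (i, ~~ b)).
  move=> ax lx; apply: (tcactus_twin_uniq lev one tc ax (Ha i b).2) => //.
  by rewrite !Hl.
have cov i b : h (Some (i, b)) \in cover (enum_val i).
  by rewrite Hc mem_cover_cycle_edges !inE; case: b; rewrite eqxx ?orbT.
have covp i : p i \in cover (enum_val i).
  by rewrite Hc mem_cover_cycle_edges !inE eqxx.
have simp (i : 'I_n) : enum_val i \in simple_cycles G.
  by case/setIdP: (enum_valP i).
have h0 i b : h (Some (i, b)) <> r.
  by move/eqP; rewrite -in_set1 -z Hl.
have hI : injective h.
  case=> [[i b]|] [[j c]|] E //; last by case: (h0 j c).
    have Ep : p j = p i.
      by apply: (par i b); rewrite E ?(Ha j c).1 // Hl.
    (* Triangles i and j share the twin point and its unique lower neighbour. *)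
    have Eij : i = j.
      apply: enum_val_inj.
      apply: (tcactus_share2 tc (simp i) (simp j) _ (cov i b) _ (covp i)).
      - by rewrite (adj_neq (Ha i b).1).
      - by rewrite E.
      by rewrite -Ep.
    subst j; congr (Some (_, _)); apply/eqP/contraT => bc.
    have := adj_neq (Ha i b).2; rewrite E.
    by have -> : ~~ b = c; [case: (b) (c) bc => [] [] | rewrite eqxx].
  by case: (h0 i b).
(* Both sides have 2n+1 elements, so every point is the root or a twin. *)
have hB : bijective h.
  apply: inj_card_bij hI _.
  by rewrite card_option card_prod card_bool card_ord cV muln2.
have [g hK gK] := hB.
pose P i := g (p i); pose l (i : 'I_n) := lv (p i).
have dP : depth P l.
  move=> i; rewrite /l -{1}[p i]gK -/(P i); case: (P i) => [[j b]|] /=.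
    by rewrite Hl.
  by apply/eqP; rewrite z set11.
exists P, l, h; split=> //; split=> // x y.
have hP i : h (P i) = p i by rewrite gK.
apply/idP/idP; last first.
  suff adj_apex_twin x' y' : apex_twin P x' y' -> adj G (h x') (h y').
    by case/orP=> /adj_apex_twin //; rewrite adj_sym.
  case: x' => [[i b]|] //= /orP[]/eqP->; first by rewrite hP; exact: (Ha i b).1.
  exact: (Ha i b).2.
have apex_twinI x' y' : adj G (h x') (h y') -> lv (h y') <= lv (h x') -> apex_twin P x' y'.
  case: x' => [[i b]|].
    move=> axy; rewrite leq_eqVlt => /orP[/eqP|] lxy.
      by apply/orP; right; apply/eqP/hI; exact: (twin _ _ _ axy).
    by apply/orP; left; apply/eqP/hI; rewrite hP; apply: par axy lxy.
  move=> axy; have /eqP -> : lv (h None) == 0 by rewrite z set11.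
  rewrite leqn0 z in_set1 => /eqP E.
  by have := adj_neq axy; rewrite E eqxx.
move=> axy; rewrite /parent_adj.
case: (leqP (lv (h y)) (lv (h x))) => lxy; first by rewrite apex_twinI.
by rewrite (@apex_twinI y x) ?orbT // 1?adj_sym // ltnW.
Qed.

(** * Isomorphism classes of rooted triangular cacti *)

Section CactusClasses.
Variable n : nat.
Local Notation pt := (option ('I_n * bool)).
Implicit Types (P Q : 'I_n -> pt) (K L : rtcactus n).

Definition rtc_labelling K P h := labelling (rtc_graph K) (rtc_root K) P h.

(** Charts reduce isomorphism of cacti to isomorphism of the standard graphs. *)
Lemma labelling_rtc_iso K L P Q h k (g : pt -> pt) :
  rtc_labelling K P h -> rtc_labelling L Q k ->
  bijective g -> g None = None ->
  (forall x y, parent_adj Q (g x) (g y) = parent_adj P x y) ->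
  rtc_iso K L.
Proof.
move=> [[h' hK h'K] h0 hA] [kB k0 kA] gB g0 gA.
have pI : injective (k \o g \o h').
  exact: inj_comp (inj_comp (bij_inj kB) (bij_inj gB)) (can_inj h'K).
apply/existsP; exists (perm pI); rewrite permE /= -h0 hK g0 k0 eqxx /=.
apply/eqP/imset_edges_adj => x y.
by rewrite !permE /= kA gA -hA !h'K.
Qed.

Lemma rtc_iso_labelling K L P Q h k :
  rtc_labelling K P h -> rtc_labelling L Q k -> rtc_iso K L ->
  exists g : pt -> pt, [/\ bijective g, g None = None &
    forall x y, parent_adj Q (g x) (g y) = parent_adj P x y].
Proof.
move=> [hB h0 hA] [[k' kK k'K] k0 kA].
case/existsP=> [p /andP[/eqP p0 /eqP/imset_edges_adj pA]].
exists (k' \o p \o h); split=> [||x y] /=.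
- exact: bij_comp (bij_comp (Bijective k'K kK) (injF_bij (@perm_inj _ p))) hB.
- by rewrite h0 p0 -k0 kK.
by rewrite -kA !k'K pA hA.
Qed.

Lemma card_pt : #|{: pt}| = 2 * n + 1.
Proof. by rewrite card_option card_prod card_ord card_bool mulnC addn1. Qed.

Definition pt_ord (x : pt) : 'I_(2 * n + 1) := cast_ord card_pt (enum_rank x).

Definition ord_pt (v : 'I_(2 * n + 1)) : pt := enum_val (cast_ord (esym card_pt) v).

Lemma pt_ordK : cancel pt_ord ord_pt.
Proof. by move=> x; rewrite /pt_ord /ord_pt cast_ordK enum_rankK. Qed.

Lemma ord_ptK : cancel ord_pt pt_ord.
Proof. by move=> x; rewrite /pt_ord /ord_pt enum_valK cast_ordKV. Qed.

Definition parent_graph P : sgraph 'I_(2 * n + 1) :=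
  graph_of (fun u v => apex_twin P (ord_pt u) (ord_pt v)).

Lemma parent_graph_labelling P : (exists l, depth P l) ->
  labelling (parent_graph P) (pt_ord None) P pt_ord.
Proof.
move=> [l dP]; split=> //; first by exists ord_pt; [exact: pt_ordK | exact: ord_ptK].
move=> x y; rewrite adj_graph_of !pt_ordK (can_eq pt_ordK) -/(parent_adj P x y).
by case: eqVneq => // ->; rewrite (parent_adj_irr _ dP).
Qed.

Lemma parent_graph_tcactus P : (exists l, depth P l) ->
  triangular_cactus (parent_graph P) && (#|triangles (parent_graph P)| == n).
Proof.
move=> wP; have [l dP] := wP.
by apply: labelling_tcactus dP (parent_graph_labelling wP).
Qed.

Definition parent_cactus P (wP : exists l, depth P l) : rtcactus n :=
  @RTCactus n (parent_graph P, pt_ord None) (parent_graph_tcactus wP).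

Lemma parent_cactus_iso P Q (wP : exists l, depth P l) (wQ : exists l, depth Q l) :
  rtc_iso (parent_cactus wP) (parent_cactus wQ) <->
  exists (p : {perm 'I_n}) f, forall i, Q (p i) = relabel p f (P i).
Proof.
have lP : rtc_labelling (parent_cactus wP) P pt_ord := parent_graph_labelling wP.
have lQ : rtc_labelling (parent_cactus wQ) Q pt_ord := parent_graph_labelling wQ.
split=> [/(rtc_iso_labelling lP lQ)[g [gB g0 gA]] | [p [f H]]].
  have [[l dP] [m dQ]] := (wP, wQ); exact: parent_adj_iso dP dQ gB g0 gA.
exact: (labelling_rtc_iso lP lQ (relabel_bij p f) erefl (parent_adj_relabel H)).
Qed.

Lemma parent_cactus_surj K :
  exists P, (exists l, depth P l) /\
    forall wP : exists l, depth P l, rtc_iso (parent_cactus wP) K.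
Proof.
have /andP[tc /eqP ct] := rtc_pairP K.
have [|P [l [h [labK dP]]]] := tcactus_labelling (rtc_root K) tc ct.
  by rewrite card_ord mul2n addn1.
exists P; split=> [|wP]; first by exists l.
have lP : rtc_labelling (parent_cactus wP) P pt_ord := parent_graph_labelling wP.
by apply: (labelling_rtc_iso (g := id) lP labK) => //; exists id.
Qed.

End CactusClasses.

(** * Signed rooted forests as parent maps *)

Section Forest.
Variables (n : nat) (F : rforest n).
Local Notation G := (rf_graph F).
Implicit Types i j v r : 'I_n.

Lemma rf_acyclic : acyclic G.
Proof. by case/andP: (rf_pairP F). Qed.

Lemma rf_root_set v : exists r, [set r in rf_roots F | connect (adj G) v r] = [set r].
Proof.
by have /andP[_ /forallP/(_ v)/cards1P] := rf_pairP F.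
Qed.

Lemma rf_one_root : {in rf_roots F &, forall r r', connect (adj G) r r' -> r = r'}.
Proof.
move=> r r' rR rR' rr'; have [x E] := rf_root_set r.
have: r \in [set x] by rewrite -E inE rR connect0.
have: r' \in [set x] by rewrite -E inE rR' rr'.
by move=> /set1P-> /set1P->.
Qed.

Definition rf_root v := odflt v [pick r in rf_roots F | connect (adj G) v r].

Lemma rf_rootP v : rf_root v \in rf_roots F /\ connect (adj G) v (rf_root v).
Proof.
rewrite /rf_root; case: pickP => [r /andP[] // | no].
have [r E] := rf_root_set v; have := set11 r.
by rewrite -E inE no.
Qed.

Definition rf_level v := dist G (rf_root v) v.

Lemma rf_leveling : leveling (adj G) (rf_roots F) rf_level.
Proof.
apply: leveling_dist rf_one_root => v; first by case: (rf_rootP v).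
by rewrite (sym_connect_sym (@adj_sym _ G)); case: (rf_rootP v).
Qed.

Lemma in_children i j : (j \in children F i) = adj G i j && (rf_level i < rf_level j).
Proof.
rewrite inE; case ij: (adj G i j) => //=.
have [iR ic] := rf_rootP i; have [jR jc] := rf_rootP j.
have uniqr r : r \in rf_roots F -> connect (adj G) i r ->
    r = rf_root i /\ r = rf_root j.
  move=> rR ir; split; apply/esym.
    exact: (one_root_connect (@adj_sym _ G) rf_one_root (connect0 _ i) iR rR ic ir).
  by apply: (one_root_connect (@adj_sym _ G) rf_one_root _ jR rR jc ir);
    rewrite connect1 // adj_sym.
have [_ Eij] := uniqr _ iR ic.
rewrite /rf_level -Eij; apply/existsP/idP => [[r /and3P[rR ir]] | lt].
  by have [-> _] := uniqr _ rR ir.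
by exists (rf_root i); rewrite iR ic.
Qed.

Lemma children_level i j : j \in children F i -> rf_level j = (rf_level i).+1.
Proof.
rewrite in_children => /andP[ij lt]; apply/eqP; rewrite eqn_leq lt andbT.
by have [_ s _] := rf_leveling; apply: s; rewrite adj_sym.
Qed.

Lemma children_asym i j : j \in children F i -> i \in children F j -> False.
Proof.
rewrite !in_children => /andP[_ h1] /andP[_ h2].
by have := ltn_trans h1 h2; rewrite ltnn.
Qed.

Lemma adj_children i j : adj G i j = (j \in children F i) || (i \in children F j).
Proof.
rewrite !in_children [adj G j i]adj_sym -andb_orr -neq_ltn.
case ij: (adj G i j) => //=.
by rewrite (forest_no_level_edge rf_leveling rf_one_root rf_acyclic ij).
Qed.

(** A second parent of j would close a cycle, as both are linked to the same root. *)
Lemma children_parent_uniq i i' j : j \in children F i -> j \in children F i' -> i = i'.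
Proof.
move=> h h'; have := children_level h; have := children_level h'.
move: h h'; rewrite !in_children [adj G i j]adj_sym [adj G i' j]adj_sym.
move=> /andP[ji _] /andP[ji' _] l' l.
exact: (forest_parent_uniq rf_leveling rf_one_root rf_acyclic ji ji').
Qed.

Lemma in_roots j : (j \in rf_roots F) = ~~ [exists i, j \in children F i].
Proof.
have [z s d] := rf_leveling; rewrite -z -[LHS]negbK -lt0n; congr (~~ _).
apply/idP/existsP => [/d[i ij E] | [i /children_level->] //].
by exists i; rewrite in_children adj_sym ij E ltnS leqnn.
Qed.

Lemma mem_child_edges i k j : j \in children F k ->
  ([set k; j] \in child_edges F i) = (k == i).
Proof.
move=> kj; apply/imsetP/eqP => [[j' ij' /set2_eq[[-> //]|[E1 E2]]] | <-].
  by subst; case: (children_asym kj ij').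
by exists j.
Qed.

End Forest.

Section ParentOfForest.
Variable n : nat.
Local Notation pt := (option ('I_n * bool)).
Implicit Types (X Y : srforest n) (i j : 'I_n).

(** The signing is defined on edges only; a non-edge gets the value false. *)
Definition sign X i j : bool :=
  [exists e : rf_edge (tag X), (val e == [set i; j]) && tagged X e].

Lemma signE X (e : rf_edge (tag X)) i j : val e = [set i; j] -> sign X i j = tagged X e.
Proof.
move=> E; apply/existsP/idP => [[e' /andP[/eqP E' h]] | h].
  by have -> : e = e' by apply: val_inj; rewrite E E'.
by exists e; rewrite E eqxx.
Qed.

Definition parent X j : pt :=
  if [pick i | j \in children (tag X) i] is Some i then Some (i, sign X i j) else None.

Lemma parentP X i j b :
  parent X j = Some (i, b) <-> j \in children (tag X) i /\ b = sign X i j.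
Proof.
rewrite /parent; case: pickP => [k jk|no]; last by split=> [//|[]]; rewrite no.
by split=> [[<- <-] //|[ji ->]]; rewrite (children_parent_uniq jk ji).
Qed.

Lemma parent_child X i j :
  j \in children (tag X) i -> parent X j = Some (i, sign X i j).
Proof. by move=> h; apply/parentP. Qed.

Lemma parent_root X j : (j \in rf_roots (tag X)) = (parent X j == None).
Proof.
rewrite in_roots /parent; case: pickP => [k jk|no].
  by apply/negbTE; rewrite negbK; apply/existsP; exists k.
by apply/negP => /existsP[i]; rewrite no.
Qed.

Lemma parent_depth X : depth (parent X) (rf_level (tag X)).
Proof.
move=> j; case E: (parent X j) => [[i b]|] /=.
  by case/parentP: E => /children_level.
have [z _ _] := rf_leveling (tag X).
by apply/eqP; rewrite z parent_root E.
Qed.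

Lemma child_edgeP X i j : j \in children (tag X) i ->
  exists e : rf_edge (tag X), val e = [set i; j].
Proof.
rewrite in_children => /andP[ij _].
by exists (Sub [set i; j] ij); rewrite SubK.
Qed.

Lemma parent_r_op X i j : parent (r_op i X) j = relabel 1%g (pred1 i) (parent X j).
Proof.
case E: (parent X j) => [[k b]|] /=; last first.
  by apply/eqP; rewrite -parent_root /= parent_root E.
case/parentP: E => kj ->; rewrite perm1; apply/parentP; split=> //=.
have [e Ee] := child_edgeP kj.
by rewrite (signE Ee) (@signE (r_op i X) e k j Ee) /= ffunE Ee mem_child_edges.
Qed.

(** Being a child is a matter of levels, and these are transported by uniqueness
    of the level function. *)
Lemma parent_iso (p : {perm 'I_n}) X Y : srf_iso_by p X Y ->
  forall j, parent Y (p j) = relabel p xpred0 (parent X j).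
Proof.
case/and3P=> /eqP hr /eqP/imset_edges_adj he /forallP hs.
have lvE : rf_level (tag Y) \o p =1 rf_level (tag X).
  apply: leveling_uniq (rf_leveling (tag X)).
  apply: leveling_comp (rf_leveling (tag Y)) => //.
    by apply: injF_bij; apply: perm_inj.
  by move=> x; rewrite -hr mem_imset //; apply: perm_inj.
have ch i j : (p j \in children (tag Y) (p i)) = (j \in children (tag X) i).
  by rewrite !in_children he -!lvE.
move=> j; case E: (parent X j) => [[i b]|] /=; last first.
  apply/eqP; rewrite -parent_root -hr mem_imset; last exact: perm_inj.
  by rewrite parent_root E.
case/parentP: E => ij ->; apply/parentP; rewrite ch; split=> //.
have [e Ee] := child_edgeP ij.
have [|e' Ee'] := @child_edgeP Y (p i) (p j); first by rewrite ch.
have /forallP hse := hs e; have /implyP := hse e'.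
rewrite Ee Ee' imsetU1 imset_set1 eqxx => /(_ isT)/eqP.
by rewrite addbF (signE Ee) (signE Ee').
Qed.

(** The parent map recovers the roots, the edges and the signs. *)
Lemma parent_isoI (p : {perm 'I_n}) X Y :
  (forall j, parent Y (p j) = relabel p xpred0 (parent X j)) -> srf_iso_by p X Y.
Proof.
move=> h.
have ch i j : (p j \in children (tag Y) (p i)) = (j \in children (tag X) i).
  apply/idP/idP => /parent_child.
    rewrite h; case E: (parent X j) => [[k b]|] //= [/perm_inj <- _].
    by case/parentP: E.
  by move=> E; have := h j; rewrite E /= => /parentP[].
have sg i j : j \in children (tag X) i -> sign Y (p i) (p j) = sign X i j.
  by move=> ij; have := h j; rewrite (parent_child ij) /= addbF => /parentP[].
apply/and3P; split.
- apply/eqP/setP=> x; rewrite -[x](permKV p) mem_imset; last exact: perm_inj.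
  by rewrite !parent_root h; case: (parent X _) => [[]|].
- by apply/eqP/imset_edges_adj => x y; rewrite !adj_children !ch.
apply/forallP=> e; apply/forallP=> e'; apply/implyP=> /eqP E; apply/eqP.
have key i j : val e = [set i; j] -> j \in children (tag X) i ->
    tagged X e = tagged Y e'.
  move=> Ee ij; rewrite -(signE Ee) -sg //; apply: signE.
  by rewrite -E Ee imsetU1 imset_set1.
have [i [j [ij Ee]]] := edgesE (valP e).
move: ij; rewrite adj_children => /orP[]; first exact: key.
by apply: key; rewrite setUC.
Qed.

(** In the forest drawn from P, the number of steps to a root is a level
    function, and following parents is constant on components, which gives one
    root in each.  A cycle is impossible: its vertex of highest level
    would have two parents. *)
Lemma parent_surj (P : 'I_n -> pt) l : depth P l -> exists X, parent X =1 P.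
Proof.
move=> dP.
pose up i j := if P j is Some (k, _) then k == i else false.
pose G := graph_of up; pose R := [set j | P j == None].
have upP i j : reflect (exists b, P j = Some (i, b)) (up i j).
  rewrite /up; case: (P j) => [[k b]|]; last by constructor=> -[].
  by apply: (iffP eqP) => [->|[c [->]]]; first exists b.
have up_level i j : up i j -> l j = (l i).+1.
  by case/upP=> b E; rewrite dP E.
have GE i j : adj G i j = up i j || up j i.
  rewrite adj_graph_of; case: eqVneq => // ->.
  by rewrite orbb; apply/esym/negP => /up_level/n_Sn.
have G_low i j : adj G i j -> l j <= l i -> up j i.
  by rewrite GE => /orP[/up_level ->|//]; rewrite ltnn.
have lev : leveling (adj G) R l.
  split=> [v | x y | v].
  - by rewrite inE dP; case: (P v) => [[]|].
  - by rewrite GE => /orP[/up_level ->|/up_level ->]; rewrite // leqW.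
  rewrite dP; case E: (P v) => [[u b]|] //= _; exists u => //.
  by rewrite GE; apply/orP; right; apply/upP; exists b.
pose up1 j := if P j is Some (k, _) then k else j.
(* rt follows the parents for as many steps as the level of j, up to a root. *)
pose rt j := iter (l j) up1 j.
have rt_up i j : up i j -> rt j = rt i.
  move=> ij; rewrite /rt (up_level _ _ ij) iterSr; congr iter.
  by case/upP: ij => b E; rewrite /up1 E.
have rt_conn x y : connect (adj G) x y -> rt x = rt y.
  case/connectP=> p pp ->; elim: p x pp => //= z p IH x /andP[xz /IH <-].
  by move: xz; rewrite GE => /orP[/rt_up|/rt_up].
have rtR r : r \in R -> rt r = r.
  by have [z _ _] := lev; rewrite -z /rt => /eqP->.
have hF : acyclic G && [forall x, #|[set r in R | connect (adj G) x r]| == 1].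
  apply/andP; split.
    apply/eqP/setP => C; rewrite [RHS]inE; apply/negP => /simple_cyclesP[c [sc uc _]].
    have [k [v [a [s [b [E va bv u vmax]]]]]] := cycle_top l uc sc.
    have inc x : x \in [:: v, a & rcons s b] -> x \in c by rewrite -E mem_rot.
    have /upP[b1 E1] : up a v.
      by apply: G_low va _; apply/vmax/inc; rewrite !inE eqxx orbT.
    have /upP[b2 E2] : up b v.
      apply: G_low; first by rewrite adj_sym.
      by apply/vmax/inc; rewrite !(in_cons, mem_rcons) eqxx !orbT.
    move: u; rewrite /= mem_rcons in_cons.
    by move: E2; rewrite E1 => -[->]; rewrite eqxx andbF.
  apply/forallP => x; apply/cards1P.
  have [r rR xr] := leveling_root lev (leqnn (l x)); exists r.
  apply/setP => r'; rewrite !inE; apply/andP/eqP => [[rR' xr'] | ->].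
    rewrite -(rtR r) // -(rt_conn _ _ (low_sub xr)) (rt_conn _ _ xr') rtR //.
    by rewrite inE.
  by split; [move: rR; rewrite inE | exact: low_sub xr].
pose F := @RForest n (G, R) hF.
pose X : srforest n := @mksrforest n F [ffun e : rf_edge F => [exists j, exists i,
  (val e == [set i; j]) && (P j == Some (i, true))]].
exists X => j.
have lF : rf_level F =1 l by apply: leveling_uniq lev; exact: rf_leveling.
case E: (P j) => [[i b]|]; last first.
  by apply/eqP; rewrite -parent_root /= inE E.
have ij : up i j by apply/upP; exists b.
have cij : j \in children (tag X) i.
  by rewrite in_children !lF (up_level _ _ ij) leqnn andbT
    -[adj _ _ _]/(adj G i j) GE ij.
apply/parentP; split=> //; have [e Ee] := child_edgeP cij.
rewrite (signE Ee) /= ffunE Ee; apply: esym.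
apply/existsP/idP => [[j' /existsP[i']] | bT].
  case/andP=> /eqP/set2_eq[[e1 e2]|[e1 e2]] /eqP E'; subst i' j'.
    by move: E'; rewrite E => -[].
  have ji : up j i by apply/upP; exists true.
  have := up_level _ _ ij; rewrite (up_level _ _ ji) => /esym/eqP.
  by rewrite -addn2 -{2}[l j]addn0 eqn_add2l.
by exists j; apply/existsP; exists i; rewrite eqxx E bT eqxx.
Qed.

End ParentOfForest.

(** * The bijection *)

Section Correspondence.
Variable n : nat.
Implicit Types X Y : srforest n.

Definition forest_cactus X : rtcactus n :=
  parent_cactus (ex_intro _ _ (parent_depth X)).

Lemma srf_step_parent X Y : srf_step X Y ->
  exists (p : {perm 'I_n}) f, forall j, parent Y (p j) = relabel p f (parent X j).
Proof.
case/orP=> [/existsP[p /parent_iso h] | /existsP[i /eqP->]].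
  by exists p, xpred0.
by exists 1%g, (pred1 i) => j; rewrite perm1 parent_r_op.
Qed.

(** Performing r_i along a list flips by the parity of the multiplicity, so every
    family of flips comes from a sequence of operations. *)
Lemma connect_flips X (s : seq 'I_n) : exists2 Y, connect (@srf_step n) X Y &
  forall j, parent Y j = relabel 1%g (fun i => odd (count_mem i s)) (parent X j).
Proof.
elim: s => [|i s [Y XY hY]].
  exists X => // j; case: (parent X j) => [[k b]|] //=.
  by rewrite perm1 addbF.
exists (r_op i Y).
  apply: connect_trans XY (connect1 _); apply/orP; right.
  by apply/existsP; exists i.
move=> j; rewrite parent_r_op hY; case: (parent X j) => [[k b]|] //=.
by rewrite !perm1 oddD oddb [(i == k)]eq_sym -addbA [odd _ (+) _]addbC.
Qed.

(** Both relations say that the parent maps differ by a relabelling; the flips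
    are performed first, and the permutation is then an isomorphism. *)
Lemma forest_cactus_iso X Y :
  rtc_iso (forest_cactus X) (forest_cactus Y) = connect (@srf_step n) X Y.
Proof.
apply/idP/idP.
  case/parent_cactus_iso => p [f h].
  (* The list has no repetition, so the parity of the multiplicity of i is f i. *)
  have [Z XZ hZ] := connect_flips X [seq i <- enum 'I_n | f i].
  apply: connect_trans XZ (connect1 _); apply/orP; left.
  apply/existsP; exists p; apply: parent_isoI => j.
  rewrite h hZ; case: (parent X j) => [[k b]|] //=.
  rewrite perm1 addbF count_uniq_mem; last by rewrite filter_uniq // enum_uniq.
  by rewrite mem_filter mem_enum andbT oddb.
case/connectP=> s st ->; elim: s X st => [|Z s IH] X /=; first by rewrite rtc_iso_refl.
case/andP=> /srf_step_parent h /IH; apply: rtc_iso_trans.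
exact/parent_cactus_iso.
Qed.

Lemma forest_cactus_surj (K : rtcactus n) : exists X, rtc_iso (forest_cactus X) K.
Proof.
have [P [wP PK]] := parent_cactus_surj K.
have [l dP] := wP; have [X XP] := parent_surj dP.
exists X; apply: rtc_iso_trans (PK wP); apply/parent_cactus_iso.
exists 1%g, xpred0 => i; rewrite XP perm1; case: (P i) => [[k b]|] //=.
by rewrite perm1 addbF.
Qed.

End Correspondence.

Local Open Scope quotient_scope.

Lemma SF_mod_sim_eq n (X Y : srforest n) :
  \pi_(SF_mod_sim n) (\pi_(SF n) X) = \pi_(SF_mod_sim n) (\pi_(SF n) Y)
  <-> connect (@srf_step n) X Y.
Proof.
have step (Z Z' : srforest n) :
    \pi_(SF n) Z = \pi_(SF n) Z' -> connect (@srf_step n) Z Z'.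
  by move/eqmodP => ZZ'; apply: connect1; apply/orP; left.
split=> [/eqmodP/existsP[X' /existsP[Y' /and3P[/eqP hX /eqP hY XY]]] | XY].
  apply: connect_trans (connect_trans XY (step _ _ hY)).
  exact: step (esym hX).
by apply/eqmodP/existsP; exists X; apply/existsP; exists Y; rewrite !eqxx.
Qed.

Lemma forest_cactus_class_eq n (X Y : srforest n) :
  \pi_(rtcactus_classes n) (forest_cactus X) =
  \pi_(rtcactus_classes n) (forest_cactus Y)
  <-> connect (@srf_step n) X Y.
Proof. by rewrite -forest_cactus_iso; split=> [/eqmodP | h]; last exact/eqmodP. Qed.

Theorem proposition5p3 (n : nat) (hn : 1 <= n) :
  exists f : SF_mod_sim n -> rtcactus_classes n, bijective f.
Proof.
pose cls (X : srforest n) : SF_mod_sim n := \pi_(SF_mod_sim n) (\pi_(SF n) X).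
have clsK (c : SF_mod_sim n) : cls (repr (repr c)) = c by rewrite /cls !reprK.
pose f (c : SF_mod_sim n) := \pi_(rtcactus_classes n) (forest_cactus (repr (repr c))).
have fE X : f (cls X) = \pi_(rtcactus_classes n) (forest_cactus X).
  by apply/forest_cactus_class_eq/SF_mod_sim_eq; apply: clsK.
have fI : injective f.
  move=> c d; rewrite -[c]clsK -[d]clsK !fE => /forest_cactus_class_eq XY.
  exact/SF_mod_sim_eq.
pose g (k : rtcactus_classes n) := cls (xchoose (forest_cactus_surj (repr k))).
have gK : cancel g f.
  move=> k; rewrite fE -[RHS]reprK; apply/eqmodP.
  exact: xchooseP (forest_cactus_surj (repr k)).
by exists f, g => // c; apply: fI; rewrite gK.
Qed.
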